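(* Let $G$ be a connected graph and let $e=vw\in E(G)$ be an edge that is not a bridge of $G$. Then $$\chi_d^t(G)-1\leq \chi_d^t(G-e)\leq \chi_d^t(G)+2.$$
   Context: All graphs are simple and finite. For a graph $H$ with no isolated vertex, a total dominator coloring (TD-coloring) of $H$ is a proper vertex coloring of $H$ in which every vertex is adjacent to every vertex of some color class (a class other than its own). The total dominator chromatic number $\chi_d^t(H)$ is the minimum number of colors in a TD-coloring of $H$. $G-e$ denotes the graph obtained from $G$ by deleting the edge $e$ (keeping all vertices). Implicitly, every graph whose $\chi_d^t$ appears has no isolated vertex. *)

(* Defs.v *)
From mathcomp Require Import all_boot.

Set Implicit Arguments.
Unset Strict Implicit.
Unset Printing Implicit Defensive.

Record sgraph := SGraph {
  vertex :> finType;
  adj : rel vertex;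
  adj_sym : symmetric adj;
  adj_irr : irreflexive adj
}.

Section DeleteEdge.
Variables (G : sgraph) (v w : G).

Definition del_adj : rel G :=
  [rel x y | adj x y && ~~ ((x == v) && (y == w) || (x == w) && (y == v))].

Lemma del_adj_sym : symmetric del_adj.
Proof.
move=> x y; rewrite /del_adj /= adj_sym; congr (_ && ~~ _).
by rewrite orbC andbC [(x == v) && _]andbC.
Qed.

Lemma del_adj_irr : irreflexive del_adj.
Proof. by move=> x; rewrite /del_adj /= adj_irr. Qed.

Definition del_edge : sgraph := SGraph del_adj_sym del_adj_irr.

End DeleteEdge.

Definition connected (G : sgraph) : bool :=
  (0 < #|G|) && [forall x : G, forall y : G, connect (@adj G) x y].

Definition num_components (G : sgraph) : nat := n_comp (@adj G) G.

Definition bridge (G : sgraph) (v w : G) : bool :=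
  adj v w && (num_components G < num_components (del_edge v w)).

Definition no_isolated (G : sgraph) : bool :=
  [forall x : G, exists y : G, adj x y].

Section TotalDominatorColoring.
Variables (G : sgraph) (C : finType) (f : G -> C).

Definition proper_coloring : bool :=
  [forall x : G, forall y : G, adj x y ==> (f x != f y)].

Definition color_class (c : C) : {set G} := [set u | f u == c].

(* A color class is the class of a color that is actually used: without
   nonemptiness, an unused color would be dominated vacuously. *)
Definition dominates_class (x : G) (c : C) : bool :=
  [&& color_class c != set0, c != f x & [forall u in color_class c, adj x u]].

Definition td_coloring : bool :=
  proper_coloring && [forall x : G, exists c : C, dominates_class x c].

End TotalDominatorColoring.

Definition td_colorable (G : sgraph) (k : nat) : bool :=
  [exists f : {ffun G -> 'I_k}, td_coloring f].

(* A graph without isolated vertices is td_colorable with #|G| colors, so the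
   search space is large enough; see td_chromaticP. If G has an isolated
   vertex, there is no TD-coloring and the value (#|G|) is meaningless. *)
Definition td_chromatic (G : sgraph) : nat :=
  [arg min_(k < ord_max : 'I_#|G|.+1 | td_colorable G k) (k : nat)].

Lemma td_colorable_card (G : sgraph) : no_isolated G -> td_colorable G #|G|.
Proof.
move=> /forallP iso; apply/existsP; exists [ffun x => enum_rank x].
apply/andP; split.
  apply/forallP=> x; apply/forallP=> y; apply/implyP=> exy.
  rewrite !ffunE (inj_eq enum_rank_inj); apply: contraTneq exy => ->.
  by rewrite adj_irr.
apply/forallP=> x; have /existsP[y exy] := iso x.
apply/existsP; exists (enum_rank y); apply/and3P; split.
- by apply/set0Pn; exists y; rewrite inE ffunE.
- rewrite ffunE (inj_eq enum_rank_inj); apply: contraTneq exy => ->.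
  by rewrite adj_irr.
- apply/forallP=> u; apply/implyP.
  by rewrite inE ffunE (inj_eq enum_rank_inj) => /eqP->.
Qed.

Lemma td_chromaticP (G : sgraph) : no_isolated G ->
  td_colorable G (td_chromatic G) /\
  forall k, td_colorable G k -> td_chromatic G <= k.
Proof.
move=> iso; rewrite /td_chromatic.
case: arg_minnP => [|k colk mink]; first exact: td_colorable_card.
split=> // j colj; case: (ltnP j #|G|.+1) => [lt_j | le_j].
  exact: (mink (Ordinal lt_j)).
by apply: leq_trans (ltnW le_j); rewrite -ltnS ltn_ord.
Qed.

(* Main.v *)
Require Import Defs.
From mathcomp Require Import all_boot.

(** For both bounds, giving one vertex [u] a fresh color of its own preserves
    properness and every domination, and makes all neighbors of [u] dominate
    the new class [{u}].
    From an optimal coloring of [G - e], isolating [v] separates [v] from [w],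
    so one extra color suffices for [G].
    From an optimal coloring of [G], deleting [e] can only spoil the dominations
    of [v] and [w]; as [e] is not a bridge, both still have neighbors in
    [G - e], and isolating one neighbor of each repairs them with two extra
    colors. *)

Definition dominates_some (G : sgraph) (C : finType) (f : G -> C) (x : G) :=
  [exists c, dominates_class f x c].

(** Naming the class by a member [y] makes it nonempty, and irreflexivity of [adj] keeps it distinct
    from the class of [x]. *)
Lemma dominates_someP (G : sgraph) (C : finType) (f : G -> C) (x : G) :
  reflect (exists y, forall u, f u = f y -> adj x u) (dominates_some G C f x).
Proof.
apply: (iffP existsP) => [[c /and3P[/set0Pn[y]]]|[y ydom]].
  rewrite inE => /eqP <- _ /forallP cdom; exists y => u fu.
  by apply: (implyP (cdom u)); rewrite inE fu.
exists (f y); apply/and3P; split.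
- by apply/set0Pn; exists y; rewrite inE.
- by apply/eqP => /esym/ydom; rewrite adj_irr.
- by apply/forallP => u; apply/implyP; rewrite inE => /eqP/ydom.
Qed.

(** Lets colors live in any finite type, so that extra colors can come from [option]. *)
Lemma td_coloring_colorable (G : sgraph) (C : finType) (f : G -> C) :
  td_coloring f -> td_colorable G #|C|.
Proof.
case/andP => /forallP fprop /forallP fdom.
apply/existsP; exists [ffun x => enum_rank (f x)]; apply/andP; split.
  apply/forallP => x; apply/forallP => y; rewrite !ffunE.
  by rewrite (inj_eq enum_rank_inj); exact: (forallP (fprop x)).
apply/forallP => x; apply/dominates_someP.
have /dominates_someP[y ydom] := fdom x; exists y => u.
by rewrite !ffunE => /enum_rank_inj/ydom.
Qed.

Definition isolate_color (G : sgraph) (C : finType) (f : G -> C) (u : G) :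
  G -> option C := fun x => if x == u then None else Some (f x).

(** The new classes refine the old ones; properness and domination survive because both pass to
    smaller nonempty classes. *)
Lemma isolate_color_eq (G : sgraph) (C : finType) (f : G -> C) (u x y : G) :
  isolate_color G C f u x = isolate_color G C f u y -> f x = f y.
Proof.
by rewrite /isolate_color; case: eqP => [->|_]; case: eqP => [->|_] // [].
Qed.

Lemma isolate_color_proper (G : sgraph) (C : finType) (f : G -> C) (u : G) :
  proper_coloring f -> proper_coloring (isolate_color G C f u).
Proof.
move=> /forallP fprop; apply/forallP => x; apply/forallP => y.
apply/implyP => exy; apply/eqP => /isolate_color_eq/eqP.
by apply/negP; exact: (implyP (forallP (fprop x) y) exy).
Qed.

Lemma isolate_color_dominates (G : sgraph) (C : finType) (f : G -> C)
    (u x : G) :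
  dominates_some G C f x ->
  dominates_some G (option C) (isolate_color G C f u) x.
Proof.
case/dominates_someP => y ydom; apply/dominates_someP; exists y => z.
by move/isolate_color_eq/ydom.
Qed.

Lemma isolate_color_adj (G : sgraph) (C : finType) (f : G -> C) (u x : G) :
  adj x u -> dominates_some G (option C) (isolate_color G C f u) x.
Proof.
move=> exu; apply/dominates_someP; exists u => z.
by rewrite /isolate_color eqxx; case: eqP => [->|].
Qed.

Lemma connect_neighbor (T : finType) (e : rel T) (x y : T) :
  connect e x y -> x != y -> exists z, e x z.
Proof.
case/connectP => [[|z p] /= exp ->]; first by rewrite eqxx.
by case/andP: exp => exz _ _; exists z.
Qed.

Lemma adj_connect_sym (G : sgraph) : connect_sym (@adj G).
Proof. exact: sym_connect_sym (@adj_sym G). Qed.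

Lemma del_edge_adj (G : sgraph) (v w x y : G) :
  adj x y -> x != v -> x != w -> @adj (del_edge v w) x y.
Proof. by move=> exy /negPf xv /negPf xw; rewrite /= /del_adj /= exy xv xw. Qed.

Lemma del_edge_sub (G : sgraph) (v w x y : G) :
  @adj (del_edge v w) x y -> adj x y.
Proof. by case/andP. Qed.

Lemma num_components_connected (G : sgraph) :
  connected G -> num_components G = 1.
Proof.
case/andP => /card_gt0P[x _] /forallP conG.
rewrite -(n_comp_connect (@adj_connect_sym G) x).
by apply: eq_n_comp_r => y; rewrite !inE; apply/esym/(forallP (conG x)).
Qed.

Lemma num_components_gt1 (G : sgraph) (x y : G) :
  ~~ connect (@adj G) x y -> 1 < num_components G.
Proof.
move=> nxy; rewrite /num_components /n_comp_mem.
apply/card_gt1P; exists (root (@adj G) x), (root (@adj G) y).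
by rewrite !inE !roots_root ?(root_connect (@adj_connect_sym G)) //;
  exact: adj_connect_sym.
Qed.

(** If deletion separated [v] from [w], the single component of [G] would become at least two,
    making the edge a bridge. *)
Lemma nonbridge_connect (G : sgraph) (v w : G) :
  connected G -> adj v w -> ~~ bridge v w ->
  connect (@adj (del_edge v w)) v w.
Proof.
move=> conG evw; rewrite /bridge evw /= num_components_connected //.
by apply: contraNT => /(num_components_gt1 (del_edge v w)).
Qed.

Lemma nonbridge_no_isolated (G : sgraph) (v w : G) :
  connected G -> adj v w -> ~~ bridge v w -> no_isolated (del_edge v w).
Proof.
move=> conG evw nbr; have cvw := nonbridge_connect _ _ _ conG evw nbr.
have vw : v != w by apply: contraTneq evw => ->; rewrite adj_irr.
apply/forallP => x; apply/existsP.
(* The ends of the deleted edge get a neighbor from the first step of a path between them that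
   avoids this edge. *)
have [->|xv] := eqVneq (x : G) v; first exact: connect_neighbor cvw vw.
have [->|xw] := eqVneq (x : G) w.
  by apply: connect_neighbor _ (v : del_edge v w) _ _;
    rewrite 1?adj_connect_sym 1?eq_sym.
(* Any other [x] has a neighbor in [G], on a path to [v], and that edge is not the deleted one. *)
case/andP: conG => _ /forallP/(_ x)/forallP/(_ v) cxv.
have [y exy] := connect_neighbor _ _ _ _ cxv xv.
by exists y; exact: del_edge_adj.
Qed.

Lemma del_edge_no_isolated (G : sgraph) (v w : G) :
  no_isolated (del_edge v w) -> no_isolated G.
Proof.
move=> /forallP iso; apply/forallP => x; apply/existsP.
by have /existsP[y /del_edge_sub exy] := iso x; exists y.
Qed.

Lemma td_colorable_undelete (G : sgraph) (v w : G) (k : nat) :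
  v != w -> td_colorable (del_edge v w) k -> td_colorable G k.+1.
Proof.
move=> vw /existsP[f /andP[/forallP fprop /forallP fdom]].
rewrite -[k]card_ord -card_option.
apply: (td_coloring_colorable _ _ (isolate_color G 'I_k f v)).
apply/andP; split.
  apply/forallP => x; apply/forallP => y; apply/implyP => exy.
  have [e'|] := boolP (@adj (del_edge v w) x y).
    apply/eqP => /isolate_color_eq/eqP; apply/negP.
    exact: (implyP (forallP (fprop x) y) e').
  (* Here [x] and [y] are [v] and [w] in some order, and only [v] is colored [None]. *)
  rewrite /= /del_adj /= exy negbK /isolate_color.
  by case/orP => /andP[/eqP -> /eqP ->]; rewrite eqxx [w == v]eq_sym (negPf vw).
apply/forallP => x; apply: isolate_color_dominates.
have /dominates_someP[y ydom] := fdom x; apply/dominates_someP.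
by exists y => u /ydom/del_edge_sub.
Qed.

Lemma td_colorable_delete (G : sgraph) (v w : G) (k : nat) :
  no_isolated (del_edge v w) -> td_colorable G k ->
  td_colorable (del_edge v w) k.+2.
Proof.
set H := del_edge v w => /forallP iso.
move=> /existsP[f /andP[/forallP fprop /forallP fdom]].
have /existsP[a eva] := iso v; have /existsP[b ewb] := iso w.
rewrite -[k]card_ord -!card_option.
apply: (td_coloring_colorable _ _
  (isolate_color H _ (isolate_color H 'I_k f a) b)).
apply/andP; split.
  do 2!apply: isolate_color_proper.
  apply/forallP => x; apply/forallP => y; apply/implyP => /del_edge_sub.
  exact: (implyP (forallP (fprop x) y)).
apply/forallP => x.
(* The outer isolation serves [w]; the inner one serves [v], and the outer one preserves that. *)
have [->|xw] := eqVneq (x : G) w; first exact: isolate_color_adj.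
apply: isolate_color_dominates.
have [->|xv] := eqVneq (x : G) v; first exact: isolate_color_adj.
apply: isolate_color_dominates.
(* Not being an end of the deleted edge, [x] keeps all its neighbors and so its old dominated
   class. *)
have /dominates_someP[y ydom] := fdom x; apply/dominates_someP.
by exists y => u /ydom exu; exact: del_edge_adj.
Qed.

Theorem theorem2p2 (G : sgraph) (v w : G) :
  connected G -> adj v w -> ~~ bridge v w ->
  td_chromatic G - 1 <= td_chromatic (del_edge v w) <= td_chromatic G + 2.
Proof.
move=> conG evw nbr.
(* [td_chromaticP] gives a true minimum only without isolated vertices; [G] inherits this from its
   subgraph. *)
have isoH := nonbridge_no_isolated _ _ _ conG evw nbr.
have vw : v != w by apply: contraTneq evw => ->; rewrite adj_irr.
have [colG minG] := td_chromaticP (del_edge_no_isolated _ _ _ isoH).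
have [colH minH] := td_chromaticP isoH.
(* The truncated subtraction becomes a successor on the other side, so each bound follows from
   minimality. *)
rewrite leq_subLR add1n addn2.
by rewrite minG ?minH //; [exact: td_colorable_delete
                          | exact: td_colorable_undelete colH].
Qed.
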